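(* For any $n\in\mathbb{N}$ with $n\ge2$ and any $M\in\mathbb{N}$ there are index sets $I\subset\mathbb{Z}^d$ with $|I|=n$ such that for every lattice rule with point set $\bm X\subset[0,1)^d$ having not more than $M$ elements, the exact Marcinkiewicz-Zygmund identity is violated, i.e. there is an $f\in V(I)$ with $$\int_{\mathbb{T}^d}|f(\bm x)|^2\,\mathrm d\bm x\ne\frac1{|\bm X|}\sum_{\bm x\in\bm X}|f(\bm x)|^2 .$$
   Context: $\mathbb{T}^d$ is the $d$-dimensional torus $[0,1)^d$ (with opposite faces identified) with normalized Lebesgue measure $\mathrm d\bm x$, and $V(I)=\operatorname{span}_{\mathbb{C}}\{\exp(2\pi\mathrm i\langle\bm k,\cdot\rangle):\bm k\in I\}$. A lattice rule is the equal-weight quadrature rule whose point set is $\bm X=L\cap[0,1)^d$, where $L\subset\mathbb{R}^d$ is an integration lattice, i.e. a discrete additive subgroup of $\mathbb{R}^d$ containing $\mathbb{Z}^d$. $\mathbb{N}=\{1,2,\dots\}$. *)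

(* Defs.v *)
(* MathComp-Analysis; complex numbers are [R[i]] from mathcomp-real-closed. *)
From HB Require Import structures.
From mathcomp Require Import all_boot all_order all_algebra finmap.
From mathcomp Require Import all_classical all_reals all_analysis.
From mathcomp.real_closed Require Import complex.

Set Implicit Arguments.
Unset Strict Implicit.
Unset Printing Implicit Defensive.

Import Order.TTheory GRing.Theory Num.Theory numFieldNormedType.Exports.
Local Open Scope classical_set_scope.
Local Open Scope complex_scope.
Local Open Scope ring_scope.

Section TuplePower.
Context {dT : measure_display} {T : measurableType dT} {R : realType}.
Variable mu : {sigma_finite_measure set T -> \bar R}.

Definition cons_pair n (p : T * n.-tuple T) : n.+1.-tuple T :=
  [tuple of p.1 :: p.2].

Lemma measurable_cons_pair n : measurable_fun [set: _] (@cons_pair n).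
Proof. exact: measurable_cons. Qed.

HB.instance Definition _ n :=
  isMeasurableFun.Build _ _ _ _ (@cons_pair n) (@measurable_cons_pair n).

Section Step.
Variables (n : nat) (m : {sigma_finite_measure set (n.-tuple T) -> \bar R}).

Definition measure_cons : set (n.+1.-tuple T) -> \bar R :=
  pushforward (mu \x m)%E (@cons_pair n).

Let measure_cons0 : measure_cons set0 = 0%E.
Proof. exact: measure0. Qed.

Let measure_cons_ge0 A : (0 <= measure_cons A)%E.
Proof. exact: measure_ge0. Qed.

Let measure_cons_sigma_additive : semi_sigma_additive measure_cons.
Proof. exact: measure_semi_sigma_additive. Qed.

HB.instance Definition _ := isMeasure.Build _ _ _ measure_cons
  measure_cons0 measure_cons_ge0 measure_cons_sigma_additive.

(* The canonical inference on [mu \x m] only finds the sigma-finiteness of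
   products of probabilities, hence the direct proof. *)
Let measure_cons_sigma_finite : sigma_finite [set: _] measure_cons.
Proof.
have /sigma_finiteP[F [FT ndF Foo]] := sigma_finiteT mu.
have /sigma_finiteP[G [GT ndG Goo]] := sigma_finiteT m.
pose H i : set (n.+1.-tuple T) :=
  [set t | F i (thead t) /\ G i [tuple of behead t]].
have HE i : @cons_pair n @^-1` H i = F i `*` G i.
  apply/funext => -[a t]; rewrite /H /preimage /= /setX /mkset /=.
  by congr (F i _ /\ G i _); apply: val_inj.
exists H.
  apply/seteqP; split => // t _.
  have [i _ Fi] : (\bigcup_i F i) (thead t) by rewrite -FT.
  have [j _ Gj] : (\bigcup_i G i) [tuple of behead t] by rewrite -GT.
  exists (maxn i j) => //; split.
    by move: Fi; exact/subsetPset/ndF/leq_maxl.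
  by move: Gj; exact/subsetPset/ndG/leq_maxr.
move=> i; have [mF Fi] := Foo i; have [mG Gi] := Goo i; split.
  apply: measurableI; rewrite -[X in measurable X]setTI.
    exact: (measurable_tnth ord0).
  exact: measurable_behead.
rewrite /measure_cons /pushforward HE product_measure1E//.
by rewrite lte_mul_pinfty// ge0_fin_numE.
Qed.

HB.instance Definition _ := Measure_isSigmaFinite.Build _ _ _
  measure_cons measure_cons_sigma_finite.

End Step.

(* The [n]-fold product of [mu]; with [mu] the Lebesgue measure on [R], this is
   the Lebesgue measure on [R^n] (on Borel sets). *)
Fixpoint measure_power n : {sigma_finite_measure set (n.-tuple T) -> \bar R} :=
  match n with
  | 0 => [the {sigma_finite_measure set _ -> \bar R} of
           \d_ ([tuple] : 0.-tuple T)]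
  | n'.+1 => [the {sigma_finite_measure set _ -> \bar R} of
           measure_cons (measure_power n')]
  end.

End TuplePower.

Section Lattice.
Context {R : realType} {d : nat}.
Implicit Types (x : 'rV[R]_d) (L X : set 'rV[R]_d) (I : {fset 'rV[int]_d}).

Definition unit_cube : set 'rV[R]_d := [set x | forall i, 0 <= x 0 i < 1].

(* [L `<=` isolated L] says that the subspace topology of [L] is discrete. *)
Definition integration_lattice L : Prop :=
  [/\ zmod_closed (mem L), L `<=` isolated L
    & range (map_mx intr : 'rV[int]_d -> 'rV[R]_d) `<=` L].

Definition lattice_points L : set 'rV[R]_d := L `&` unit_cube.

Definition expi2pi (t : R) : R[i] := cos (2 * pi * t) +i* sin (2 * pi * t).

Definition dotZ (k : 'rV[int]_d) x : R := \sum_i (k 0 i)%:~R * x 0 i.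

Definition trig_space I : set ('rV[R]_d -> R[i]) :=
  [set f | exists c : 'rV[int]_d -> R[i],
     f = fun x => \sum_(k <- I) c k * expi2pi (dotZ k x)].

Definition sqnorm (z : R[i]) : R := complex.ComplexField.Normc.normc z ^+ 2.

Definition row_of_tuple (t : d.-tuple (measurableTypeR R)) : 'rV[R]_d :=
  \row_i tnth t i.

(* Row vectors carry no sigma-algebra in the library, tuples do: the integral is
   taken over tuples. The Lebesgue measure of the half-open unit cube is 1, so no normalization
   factor is needed on the torus. *)
Definition torus_mean_square (f : 'rV[R]_d -> R[i]) : \bar R :=
  (\int[measure_power (@lebesgue_measure R) d]_(t in row_of_tuple @^-1` unit_cube)
     (sqnorm (f (row_of_tuple t)))%:E)%E.

Definition quadrature_mean_square X (f : 'rV[R]_d -> R[i]) : R :=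
  #|` fset_set X|%:R^-1 * \sum_(x \in X) sqnorm (f x).

End Lattice.

(* Main.v *)
(* If L has at most M points in the unit cube then L/Z^d has at most M elements,
   so M! L is contained in Z^d. Hence exp(2 pi i M! x_1) = 1 at every node, and
   f(x) = 1 - exp(2 pi i M! x_1) is invisible to the quadrature, while |f|^2 is
   positive for 0 < x_1 < 1/M!. It suffices that I contains 0 and M! e_1. *)
Require Import Defs.
From mathcomp Require Import all_boot all_order all_algebra finmap.
From mathcomp Require Import all_classical all_reals all_analysis.
From mathcomp.real_closed Require Import complex.
From mathcomp Require Import measurable_realfun ring.

Set Implicit Arguments.
Unset Strict Implicit.
Unset Printing Implicit Defensive.

Import Order.TTheory GRing.Theory Num.Theory numFieldNormedType.Exports.
Local Open Scope classical_set_scope.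
Local Open Scope complex_scope.
Local Open Scope ring_scope.

Lemma sin_pi_intr (R : realType) (m : int) : sin (pi * m%:~R) = 0 :> R.
Proof.
have sinN_nat n : sin (pi * n%:R) = 0 :> R.
  by rewrite mulr_natr -[_ *+ n]add0r (alternatingn (@sinDpi R)) sin0 mulr0.
case: m => n; first exact: sinN_nat.
by rewrite NegzE mulrNz mulrN sinN sinN_nat oppr0.
Qed.

(** Double-angle formulas at [pi * s]. In the sine form both uses can be read off: the value is zero
    when [s] is an integer and positive when [0 < s < 1]. *)
Lemma sqnorm_one_sub_expi2pi (R : realType) (s : R) :
  sqnorm (1 - expi2pi s) = 4 * sin (pi * s) ^+ 2.
Proof.
rewrite /sqnorm /expi2pi /= sqr_sqrtr; last by rewrite addr_ge0 ?sqr_ge0.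
have -> : 2 * pi * s = (pi * s) *+ 2 by rewrite -mulrA mulr_natl.
rewrite sin_mulr2n cos_mulr2n.
have := cos2Dsin2 (pi * s); move: (cos _) (sin _) => c z cz.
have cE : c ^+ 2 = 1 - z ^+ 2 by rewrite -cz addrK.
rewrite sub0r sqrrN -(mulr_natl (c * z)) -(mulr_natl (c ^+ 2)) !exprMn.
rewrite cE.
ring.
Qed.

(** If the integral were zero, the nonnegative [f] would vanish outside a null set; that set
    contains [A], which is not null. *)
Lemma integral_neq0 d (T : measurableType d) (R : realType)
    (mu : {measure set T -> \bar R}) (D A : set T) (f : T -> \bar R) :
  measurable D -> measurable_fun D f -> (forall x, D x -> (0 <= f x)%E) ->
  measurable A -> A `<=` D -> mu A <> 0%E -> (forall x, A x -> f x <> 0%E) ->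
  (\int[mu]_(x in D) f x)%E <> 0%E.
Proof.
move=> mD mf f0 mA AD muA fA int0; apply: muA.
have : (\int[mu]_(x in D) `|f x|)%E = 0%E.
  by rewrite -int0; apply: eq_integral => x /set_mem Dx; rewrite gee0_abs ?f0.
move=> /(ae_eq_integral_abs mu mD mf) [B [mB muB subB]].
apply/(measure_negligible mA); exists B; split=> // x Ax.
by apply: subB => /(_ (AD _ Ax)) /fA; apply.
Qed.

Lemma measurable_box (R : realType) (d : nat) (J : interval R) :
  measurable [set t : d.-tuple (measurableTypeR R) |
    forall i, [set` J] (tnth t i)].
Proof.
have -> : [set t : d.-tuple (measurableTypeR R) | forall i, [set` J] (tnth t i)]
   = \bigcap_(i in [set: 'I_d]) ((fun t => tnth t i) @^-1` [set` J]).
  apply/seteqP; split => [t tJ i _|t tJ i]; [exact: tJ|exact: (tJ i I)].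
apply: fin_bigcap_measurable => // i _; rewrite -[X in measurable X]setTI.
exact: measurable_tnth.
Qed.

(** Induction on [d]: under [cons_pair] the box pulls back to the product of [J] with the box one
    dimension lower. *)
Lemma measure_power_box (R : realType) (d : nat) (J : interval R) :
  measure_power (@lebesgue_measure R) d
    [set t | forall i, [set` J] (tnth t i)]
  = ((@lebesgue_measure R) [set` J] ^+ d)%E.
Proof.
elim: d => [|d IH].
  (* In dimension 0 the condition on the coordinates is vacuous, so the box is the whole one-point
     space, of Dirac mass 1. *)
  by rewrite expe0 /= diracE mem_set// => -[].
rewrite expeS -IH -product_measure1E//; last exact: measurable_box.
rewrite /= /measure_cons /pushforward; congr (_ _).
apply/seteqP; split => -[a t] /=.
  move=> aJ; split; first by have := aJ ord0; rewrite tnth0.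
  by move=> i; have := aJ (lift ord0 i); rewrite tnthS.
case=> aJ tJ i; case: (unliftP ord0 i) => [j|] ->; first by rewrite tnthS.
by rewrite tnth0.
Qed.

Lemma lattice_torsion (R : realType) (d M : nat) (L : set 'rV[R]_d) x :
  integration_lattice L -> (lattice_points L #<= `I_M)%card -> L x ->
  exists2 m, (0 < m <= M)%N & forall i, x 0 i *+ m \is a Num.int.
Proof.
move=> [[L0 LB] _ LZ] cardL Lx; apply: contrapT => torsion_free.
have LN y : L y -> L (- y).
  by move=> Ly; apply: set_mem; rewrite -sub0r; apply: LB => //; apply: mem_set.
have LD y z : L y -> L z -> L (y + z).
  move=> Ly Lz; apply: set_mem; rewrite -[z]opprK; apply: LB; apply: mem_set => //.
  exact: LN.
have LM j : L (x *+ j).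
  by elim: j => [|j IH]; [exact: set_mem L0 | rewrite mulrS; apply: LD].
(* Pigeonhole on the reductions of 0, x, ..., M x modulo Z^d: two coincide. *)
pose g j : 'rV[R]_d :=
  x *+ j - map_mx intr (\row_i Num.floor (x 0 i *+ j)).
have gE j i : g j 0 i = x 0 i *+ j - (Num.floor (x 0 i *+ j))%:~R.
  by rewrite mxE mulmxnE !mxE.
have gL : {homo g : j / `I_M.+1 j >-> lattice_points L j}.
  move=> j _; split.
    by apply: LD; [exact: LM | apply: LN; apply: LZ; eexists].
  move=> i; rewrite gE subr_ge0 floor_le /= ltrBlDr addrC.
  by have := floorD1_gt (x 0 i *+ j); rewrite intrD.
have ginj : {in `I_M.+1 &, injective g}.
  suff lt_neq j k : (j < k <= M)%N -> g j <> g k.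
    move=> j k /set_mem jM /set_mem kM gjk.
    case: (ltngtP j k) => // [jk|kj]; [case: (lt_neq j k)|case: (lt_neq k j)].
    - by rewrite jk -ltnS.
    - exact: gjk.
    - by rewrite kj -ltnS.
    - by [].
  (* If [g j = g k], then [x *+ (k - j)] is a difference of two integer parts in each coordinate, so
     [k - j] is a forbidden multiplier. *)
  move=> /andP[jk kM] gjk; apply: torsion_free; exists (k - j)%N.
    by rewrite subn_gt0 jk (leq_trans (leq_subr _ _)).
  move=> i; rewrite mulrnBr ?(ltnW jk)//.
  have /eqP := congr1 (fun v : 'rV[R]_d => v 0 i) gjk; rewrite !gE.
  rewrite -subr_eq0 => /eqP e.
  have -> : x 0 i *+ k - x 0 i *+ j =
     (Num.floor (x 0 i *+ k))%:~R - (Num.floor (x 0 i *+ j))%:~R.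
    by apply/eqP; rewrite -subr_eq0; apply/eqP; rewrite -[RHS]oppr0 -e; ring.
  by rewrite rpredB ?intr_int.
have : (`I_M.+1 #<= `I_M)%card.
  apply: card_le_trans cardL.
  by apply/pcard_leP/injfunPex; exists g.
by rewrite card_le_II ltnn.
Qed.

(** The multiplier [m] found for [x] depends on [x]; since [m <= M] it divides the factorial of [M],
    which therefore serves all lattice points at once. *)
Lemma lattice_torsion_fact (R : realType) (d M : nat) (L : set 'rV[R]_d) x :
  integration_lattice L -> (lattice_points L #<= `I_M)%card -> L x ->
  forall i, M`!%:R * x 0 i \is a Num.int.
Proof.
move=> latL cardL Lx i.
have [m mM xm] := lattice_torsion latL cardL Lx.
have /dvdnP[q ->] := dvdn_fact mM.
by rewrite natrM -mulrA rpredM ?natr_int// mulr_natl.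
Qed.

Lemma dotZ_delta (R : realType) (d : nat) (i : 'I_d) (a : int) (x : 'rV[R]_d) :
  dotZ (a *: delta_mx 0 i) x = a%:~R * x 0 i.
Proof.
rewrite /dotZ (bigD1 i)//= big1 ?addr0 => [|j ji].
  by rewrite !mxE !eqxx mulr1.
by rewrite !mxE eqxx (negbTE ji) mulr0 mul0r.
Qed.

Lemma dotZ0 (R : realType) (d : nat) (x : 'rV[R]_d) : dotZ 0 x = 0.
Proof. by rewrite /dotZ big1// => i _; rewrite mxE mul0r. Qed.

Lemma trig_space_one_sub (R : realType) (d : nat) (I : {fset 'rV[int]_d})
    (k : 'rV[int]_d) :
  0 \in I -> k \in I -> k != 0 ->
  trig_space I (fun x : 'rV[R]_d => 1 - expi2pi (dotZ k x)).
Proof.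
move=> I0 Ik k0.
(* The constant 1 is the exponential of frequency 0; [k != 0] keeps the two nonzero coefficients at
   distinct frequencies. *)
exists (fun l => if l == 0 then 1 else if l == k then -1 else 0).
apply/funext => x.
rewrite (big_rem 0)//= eqxx (big_rem k)/=; last first.
  by rewrite mem_rem_uniq ?fset_uniq// inE k0.
rewrite (negbTE k0) eqxx big_seq big1 ?addr0.
  by rewrite mul1r mulN1r dotZ0 {2}/expi2pi mulr0 cos0 sin0.
move=> l; rewrite mem_rem_uniq ?rem_uniq ?fset_uniq// inE => /andP[lk].
rewrite mem_rem_uniq ?fset_uniq// inE => /andP[/negbTE-> _].
by rewrite (negbTE lk) mul0r.
Qed.

Lemma measurable_sqnorm_one_sub_expi2pi (R : realType) (d : nat) (i : 'I_d)
    (a : R) (D : set (d.-tuple (measurableTypeR R))) :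
  measurable_fun D
    (fun t => (sqnorm (1 - expi2pi (a * tnth t i)))%:E).
Proof.
under eq_fun do rewrite sqnorm_one_sub_expi2pi mulrA.
apply: measurable_funTS; apply/measurable_EFinP.
apply: measurable_funM; first exact: measurable_cst.
apply: measurable_funX; apply: measurableT_comp.
  by apply: continuous_measurable_fun; exact: continuous_sin.
by apply: measurable_funM; [exact: measurable_cst|exact: measurable_tnth].
Qed.

Lemma torus_mean_square_one_sub_neq0 (R : realType) (d : nat) (i : 'I_d)
    (a : nat) :
  (0 < a)%N ->
  torus_mean_square (fun x : 'rV[R]_d =>
    1 - expi2pi (dotZ (a%:Z *: delta_mx 0 i) x)) <> 0%E.
Proof.
move=> a0; rewrite /torus_mean_square.
under eq_integral do rewrite dotZ_delta mxE.
have a0R : 0 < a%:R :> R by rewrite ltr0n.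
have cubeE : row_of_tuple @^-1` unit_cube =
    [set t : d.-tuple (measurableTypeR R) |
      forall i, [set` `[0, 1[] (tnth t i)].
  by apply/seteqP; split => t /= tP j; have := tP j; rewrite /= in_itv mxE.
rewrite cubeE.
(* On this box [0 < a * t_i < 1], so the sine is positive. Bounding every coordinate the same way
   lets [measure_power_box] give its volume, [a ^- d], and [1 <= a] places it inside the unit
   cube. *)
pose A := [set t : d.-tuple (measurableTypeR R) |
  forall j, [set` `]0%R, (a%:R^-1)%R[] (tnth t j)].
apply: (integral_neq0 (A := A)).
- exact: measurable_box.
- exact: measurable_sqnorm_one_sub_expi2pi.
- by move=> t _; rewrite lee_fin sqr_ge0.
- exact: measurable_box.
- move=> t /= tP j; have := tP j; rewrite !in_itv/= => /andP[/ltW->].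
  move=> /lt_le_trans-> //.
  by rewrite invf_le1 // ler1n.
- rewrite [X in X <> _]measure_power_box lebesgue_measure_itv/= lte_fin invr_gt0 a0R oppr0 adde0.
  by apply/eqP; rewrite -EFin_expe eqe expf_neq0// invr_neq0// gt_eqF.
- move=> t /= /(_ i); rewrite /= in_itv/= => /andP[t0 ta].
  rewrite sqnorm_one_sub_expi2pi => -[] /eqP; apply/negP.
  rewrite mulf_neq0 ?pnatr_eq0// expf_neq0// gt_eqF// sin_gt0_pi//.
  rewrite mulr_gt0 ?pi_gt0 ?mulr_gt0//= gtr_pMr ?pi_gt0//.
  by rewrite mulrC -ltr_pdivlMr// div1r.
Qed.

Theorem corollary5p3 (R : realType) (d n M : nat)
  (hd : (1 <= d)%N) (hn : (2 <= n)%N) (hM : (1 <= M)%N) :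
  exists I : {fset 'rV[int]_d}, #|` I| = n /\
    forall L : set 'rV[R]_d, integration_lattice L ->
      (lattice_points L #<= `I_M)%card ->
      exists2 f : 'rV[R]_d -> R[i], trig_space I f &
        torus_mean_square f <>
          (quadrature_mean_square (lattice_points L) f)%:E.
Proof.
pose i0 : 'I_d := Ordinal hd.
(* Multiples of one vector give as many distinct frequencies as wanted; [k 0] and [k 1] carry the
   counterexample and the others bring the size of the index set to [n]. Both lie in it because
   [2 <= n]. *)
pose k (j : nat) : 'rV[int]_d := (j * M`!)%N%:Z *: delta_mx 0 i0.
have k_inj : injective k.
  move=> j l /(congr1 (fun v : 'rV[int]_d => v 0 i0)).
  rewrite !mxE !eqxx !mulr1 => -[] /eqP.
  by rewrite eqn_pmul2r ?fact_gt0// => /eqP.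
have k0 : k 0%N = 0 by rewrite /k mul0n scale0r.
exists (seq_fset tt (map k (iota 0 n))); split.
  by rewrite size_seq_fset undup_id ?map_inj_uniq ?iota_uniq// size_map size_iota.
move=> L latL cardL; exists (fun x => 1 - expi2pi (dotZ (k 1%N) x)).
  apply: trig_space_one_sub.
  - by rewrite seq_fsetE -k0 map_f// mem_iota (ltnW hn).
  - by rewrite seq_fsetE map_f// mem_iota hn.
  - by rewrite -k0 (inj_eq k_inj).
(* The quadrature sum vanishes term by term: at each node the first coordinate times the factorial
   of [M] is an integer, where the sine is zero. *)
rewrite /quadrature_mean_square fsbig1; last first.
  move=> x [Lx _]; rewrite sqnorm_one_sub_expi2pi dotZ_delta mul1n.
  have /intrP[m ->] := lattice_torsion_fact latL cardL Lx i0.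
  by rewrite sin_pi_intr expr0n mulr0.
by rewrite mulr0 /k mul1n; apply/torus_mean_square_one_sub_neq0/fact_gt0.
Qed.
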